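(* Let $\mathcal{H}$ be an infinite-dimensional separable complex Hilbert space and let $\{\Lambda_i\}_{i\in J}$, $\Lambda_i\in\mathcal{L}(\mathcal{H},\mathcal{H}_i)$, be a g-frame for $\mathcal{H}$ with respect to $\{\mathcal{H}_i\}_{i\in J}$. Then there exist g-orthonormal bases $\{\Upsilon_i\}_{i\in J}$, $\{\Gamma_i\}_{i\in J}$, $\{\Psi_i\}_{i\in J}$ for $\mathcal{H}$ with respect to $\{\mathcal{H}_i\}_{i\in J}$ and a constant $a$ such that $\Lambda_i=a(\Upsilon_i+\Gamma_i+\Psi_i)$ for all $i\in J$.
   Context: $J\subseteq\mathbb{Z}$ is an index set, $\{\mathcal{H}_i\}_{i\in J}$ is a sequence of separable complex Hilbert spaces (closed subspaces of some separable Hilbert space $\mathcal{K}$), and $\mathcal{L}(\mathcal{H},\mathcal{H}_i)$ is the set of bounded linear operators $\mathcal{H}\to\mathcal{H}_i$. A family $\{\Lambda_i\}_{i\in J}$ with $\Lambda_i\in\mathcal{L}(\mathcal{H},\mathcal{H}_i)$ is a g-frame for $\mathcal{H}$ (with respect to $\{\mathcal{H}_i\}$) if there are constants $A,B>0$ with $A\|f\|^2\le\sum_{i\in J}\|\Lambda_if\|^2\le B\|f\|^2$ for all $f\in\mathcal{H}$. It is a g-orthonormal basis for $\mathcal{H}$ if $\langle\Lambda_i^{\star}g_i,\Lambda_j^{\star}g_j\rangle=\delta_{i,j}\langle g_i,g_j\rangle$ for all $i,j\in J$, $g_i\in\mathcal{H}_i$, $g_j\in\mathcal{H}_j$, and $\sum_{i\in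 J}\|\Lambda_if\|^2=\|f\|^2$ for all $f\in\mathcal{H}$. *)

(* Defs.v *)
From HB Require Import structures.
From mathcomp Require Import all_boot all_order all_algebra sesquilinear.
From mathcomp Require Import complex.
From mathcomp Require Import all_classical all_reals all_analysis.

Set Implicit Arguments.
Unset Strict Implicit.
Unset Printing Implicit Defensive.

Import Order.TTheory GRing.Theory Num.Theory.
Import numFieldNormedType.Exports.

Local Open Scope classical_set_scope.
Local Open Scope ring_scope.

(* The inner product is linear in the first variable and conjugate-linear in
   the second, as [{dot H for Num.conj}] prescribes. *)
HB.mixin Record CompleteNormedModule_isHilbert (R : realType) (H : Type)
    of CompleteNormedModule (complex R) H := {
  inner : {dot H for Num.conj};
  sqr_norm_inner : forall x : H, `|x| ^+ 2 = inner x x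
}.

#[short(type="hilbertType")]
HB.structure Definition Hilbert (R : realType) :=
  {H of CompleteNormedModule (complex R) H &
        CompleteNormedModule_isHilbert R H}.

Section hilbert_space.
Context {R : realType}.
Implicit Types H K : hilbertType R.

(* The norm of a module over [complex R] takes values in [complex R]; being
   nonnegative, it is real and equal to its real part. *)
Definition hnorm H (x : H) : R := complex.Re `|x|.

Definition separable_space H : Prop := exists2 D : set H, countable D & dense D.

Definition infinite_dimensional H : Prop :=
  ~ exists (n : nat) (e : 'I_n -> H),
      forall x : H, exists c : 'I_n -> complex R, x = \sum_(k < n) c k *: e k.

Record bounded_operator H K := BoundedOperator {
  bop_fun :> {linear H -> K};
  bop_bounded : exists M : R, forall f : H, hnorm (bop_fun f) <= M * hnorm f
}.

(* The defining relation has at most one solution S, since the inner product is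
   definite; completeness of H (Riesz representation) provides one. *)
Definition adjoint H K (T : bounded_operator H K) : K -> H :=
  get [set S : K -> H | forall f g, inner (T f) g = inner f (S g)].

End hilbert_space.

Section gframe.
Context {R : realType} {J : set int}.
Variables (H : hilbertType R) (H_ : J -> hilbertType R).
Variable Lambda : forall i : J, bounded_operator H (H_ i).

Definition gframe : Prop :=
  exists A B : R, [/\ 0 < A, 0 < B & forall f : H,
    ((A * hnorm f ^+ 2)%:E <= \esum_(i in [set: J]) (hnorm (Lambda i f) ^+ 2)%:E
       <= (B * hnorm f ^+ 2)%:E)%E].

(* The condition <Lambda_i^* g_i, Lambda_j^* g_j> = delta_ij <g_i, g_j> is
   split according to whether i = j: for i <> j the factor <g_i, g_j>, which
   would require a common ambient space, is multiplied by 0. *)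
Definition gorthonormal_basis : Prop :=
  [/\ forall (i : J) (g g' : H_ i),
        inner (adjoint (Lambda i) g) (adjoint (Lambda i) g') = inner g g',
      forall (i j : J) (gi : H_ i) (gj : H_ j), i <> j ->
        inner (adjoint (Lambda i) gi) (adjoint (Lambda j) gj) = 0
    & forall f : H,
        \esum_(i in [set: J]) (hnorm (Lambda i f) ^+ 2)%:E = (hnorm f ^+ 2)%:E].

End gframe.

(* Main.v *)
(** Since the analysis operator is bounded below and H is infinite-dimensional,
the H_i together have countably infinitely many basis vectors, so they can be
matched bijectively with an orthonormal basis of H.  This gives one
g-orthonormal basis (Th_i), and Lambda_i = Th_i T for a bounded operator T on
H.  It remains to write a small multiple S of T as U1 + U2 - 1 with U1, U2
unitary, for then Th_i U1, Th_i U2 and - Th_i are g-orthonormal bases.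

Put K = 1 + S.  When S is small there is a self-adjoint X, commuting with
K^* K, such that K^* K (1 + 3 X^2) = 4; then U = K (1 + i sqrt 3 X) / 2 and
K (1 - i sqrt 3 X) / 2 are unitary and add up to K.  The operator X is
1 + 2 Y, where Y is obtained from D = (1 - K^* K) / 3 by iterating a
contraction whose iterates are polynomials in D. *)

From HB Require Import structures.
Require Import Defs.
From mathcomp Require Import all_boot all_order all_algebra sesquilinear.
From mathcomp Require Import complex.
From mathcomp Require Import all_classical all_reals all_analysis.
From mathcomp Require Import ring lra.

Set Implicit Arguments.
Unset Strict Implicit.
Unset Printing Implicit Defensive.

Import Order.TTheory GRing.Theory Num.Theory.
Import numFieldNormedType.Exports.

Local Open Scope classical_set_scope.
Local Open Scope ring_scope.

(** * Inner product and real-valued norm *)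

Section inner_product.
Context {R : realType} {H : hilbertType R}.
Implicit Types x y z : H.
Local Notation C := (complex R).

Lemma innerDl x y z : inner (x + y) z = inner x z + inner y z.
Proof. exact: linearDl. Qed.
Lemma innerDr x y z : inner z (x + y) = inner z x + inner z y.
Proof. exact: linearDr. Qed.
Lemma innerBl x y z : inner (x - y) z = inner x z - inner y z.
Proof. exact: linearBl. Qed.
Lemma innerBr x y z : inner z (x - y) = inner z x - inner z y.
Proof. exact: linearBr. Qed.
Lemma innerNl x z : inner (- x) z = - inner x z.
Proof. exact: linearNl. Qed.
Lemma innerNr x z : inner z (- x) = - inner z x.
Proof. exact: linearNr. Qed.
Lemma innerZl (a : C) x z : inner (a *: x) z = a * inner x z.
Proof. exact: linearZl_LR. Qed.
Lemma innerZr (a : C) x z : inner z (a *: x) = Num.conj a * inner z x.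
Proof. exact: linearZr_LR. Qed.
Lemma innerC x y : inner x y = Num.conj (inner y x).
Proof. by rewrite (hermC _ x y) mul1r. Qed.
Lemma inner0l z : inner 0 z = 0 :> C. Proof. exact: linear0l. Qed.
Lemma inner0r z : inner z 0 = 0 :> C. Proof. exact: linear0r. Qed.
Lemma inner_suml I (r : seq I) (P : pred I) (F : I -> H) z :
  inner (\sum_(i <- r | P i) F i) z = \sum_(i <- r | P i) inner (F i) z.
Proof. exact: linear_sumlz. Qed.
Lemma inner_sumr I (r : seq I) (P : pred I) (F : I -> H) z :
  inner z (\sum_(i <- r | P i) F i) = \sum_(i <- r | P i) inner z (F i).
Proof. exact: linear_sumr. Qed.

Lemma innerxx x : inner x x = `|x| ^+ 2.
Proof. by rewrite sqr_norm_inner. Qed.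

Lemma inner_eq0 x : inner x x = 0 -> x = 0.
Proof. by rewrite innerxx => /eqP; rewrite sqrf_eq0 normr_eq0 => /eqP. Qed.

Lemma innerC0 x y : inner x y = 0 -> inner y x = 0.
Proof. by move=> h; rewrite innerC h rmorph0. Qed.

Lemma eq_inner x y : (forall z, inner x z = inner y z) -> x = y.
Proof.
move=> h; apply/eqP; rewrite -subr_eq0; apply/eqP/inner_eq0.
by rewrite innerBl h subrr.
Qed.

Lemma cauchy_schwarz x y : `|inner x y| <= `|x| * `|y|.
Proof.
have [->|y0] := eqVneq y 0; first by rewrite inner0r !normr0 mulr0.
have ny0 : 0 < `|y| by rewrite normr_gt0.
rewrite -(@ler_pXn2r _ 2) ?nnegrE ?mulr_ge0//.
(* [t *: y] is the orthogonal projection of [x] onto the line of [y]; the residual has nonnegative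
   squared norm. *)
pose t := inner x y / `|y| ^+ 2.
have : 0 <= inner (x - t *: y) (x - t *: y) by rewrite innerxx exprn_ge0.
have -> : inner (x - t *: y) (x - t *: y)
    = `|x| ^+ 2 - `|inner x y| ^+ 2 / `|y| ^+ 2.
  rewrite !innerBl !innerBr !innerZl !innerZr !innerxx (innerC y x).
  rewrite normCK (_ : Num.conj t = Num.conj (inner x y) / `|y| ^+ 2); last first.
    rewrite /t rmorphM fmorphV.
    by congr (_ * _^-1); apply: conj_Creal; rewrite realX ?normr_real.
  rewrite /t.
  by field; rewrite gt_eqF.
by rewrite subr_ge0 ler_pdivrMr ?exprn_gt0// exprMn.
Qed.

Lemma hnormE x : (hnorm x)%:C%C = `|x|.
Proof. by rewrite /hnorm RRe_real// ger0_real. Qed.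

Lemma hnorm_ge0 x : 0 <= hnorm x.
Proof. by rewrite -ler0c hnormE. Qed.

Lemma ler_hnormD x y : hnorm (x + y) <= hnorm x + hnorm y.
Proof. by rewrite -lecR rmorphD /= !hnormE ler_normD. Qed.

Lemma hnorm_opp x : hnorm (- x) = hnorm x.
Proof. by rewrite /hnorm normrN. Qed.

Lemma ler_hnormB x y : hnorm (x - y) <= hnorm x + hnorm y.
Proof. by rewrite -(hnorm_opp y) ler_hnormD. Qed.

Lemma hnormZr (a : R) x : hnorm (a%:C%C *: x) = `|a| * hnorm x.
Proof.
apply: (@complexI R); rewrite rmorphM /= !hnormE normrZ; congr (_ * _).
by rewrite normc_def /= expr0n /= addr0 sqrtr_sqr.
Qed.

Lemma hnormZ (a : C) x : hnorm (a *: x) = complex.Re `|a| * hnorm x.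
Proof.
by apply: (@complexI R); rewrite rmorphM /= !hnormE normrZ; congr (_ * _).
Qed.

Lemma hnorm0 : hnorm (0 : H) = 0.
Proof. by rewrite /hnorm normr0. Qed.

Lemma hnorm_eq0 x : hnorm x = 0 -> x = 0.
Proof. by move=> h; apply/eqP; rewrite -normr_eq0 -hnormE h. Qed.

Lemma hnorm2 x : ((hnorm x) ^+ 2)%:C%C = inner x x.
Proof. by rewrite rmorphXn /= hnormE innerxx. Qed.

End inner_product.

Lemma eq_hnorm {R : realType} {H K : hilbertType R} (x : H) (y : K) :
  inner x x = inner y y -> hnorm x = hnorm y.
Proof.
move=> h; apply/eqP; rewrite -(@eqrXn2 _ 2) ?hnorm_ge0//; apply/eqP.
by apply: (@complexI R); rewrite !hnorm2.
Qed.

(** * Convergence and continuity of the inner product *)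

Section limits.
Context {R : realType} {H : hilbertType R}.
Implicit Types x y : nat -> H.
Local Notation C := (complex R)^o.

Lemma cvg_hnormP x (l : H) :
  x @ \oo --> l <-> forall e : R, 0 < e -> \forall n \near \oo, hnorm (l - x n) < e.
Proof.
split=> [/cvgrPdist_lt h e e0|h].
  have /h : 0 < e%:C%C by rewrite ltcR.
  by apply: filterS => n; rewrite -hnormE ltcR.
(* A positive element of [complex R] is real, so it may be replaced by its real part. *)
apply/cvgrPdist_lt => e e0; have ee : (complex.Re e)%:C%C = e.
  by rewrite RRe_real// gtr0_real.
have : 0 < complex.Re e by rewrite -ltcR ee.
by move=> /h; apply: filterS => n; rewrite -[in X in _ -> X]hnormE -ee ltcR.
Qed.

Lemma cvg_hcauchy x :
  (forall e : R, 0 < e -> exists N, forall m n, (N <= m <= n)%N ->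
     hnorm (x n - x m) < e) -> cvg (x @ \oo).
Proof.
move=> h; apply/cauchy_cvgP/cauchy_exP => e e0.
have ee : (complex.Re e)%:C%C = e by rewrite RRe_real// gtr0_real.
have /h[N hN] : 0 < complex.Re e by rewrite -ltcR ee.
exists (x N), N => // n /= Nn; rewrite -ball_normE /= -normrN opprB.
by rewrite -hnormE -ee ltcR hN// leqnn.
Qed.

(** The difference <x_n, y_n> - <l, m> splits as <x_n - l, y_n> + <l, y_n - m>, and Cauchy-Schwarz
    sends both terms to 0. *)
Lemma cvg_inner x y (l m : H) : x @ \oo --> l -> y @ \oo --> m ->
  (fun n => inner (x n) (y n) : C) @ \oo --> (inner l m : C).
Proof.
move=> xl ym.
have p1 : (fun n => inner (x n - l) (y n) : C) @ \oo --> (0 : C).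
  have : (fun n => `|x n - l| * `|y n| : C) @ \oo --> (0 : C).
    rewrite -(mul0r `|m|); apply: cvgM; last exact: cvg_norm.
    by apply/norm_cvg0P/subr_cvg0.
  move=> /cvgr0Pnorm_lt h; apply/cvgr0Pnorm_lt => e e0.
  have := h e e0; apply: filterS => n; apply: le_lt_trans.
  by rewrite [leRHS]ger0_norm ?mulr_ge0//; exact: cauchy_schwarz.
have p2 : (fun n => inner l (y n - m) : C) @ \oo --> (0 : C).
  have : (fun n => `|l| * `|y n - m| : C) @ \oo --> (0 : C).
    rewrite -(mulr0 `|l|); apply: cvgM; first exact: cvg_cst.
    by apply/norm_cvg0P/subr_cvg0.
  move=> /cvgr0Pnorm_lt h; apply/cvgr0Pnorm_lt => e e0.
  have := h e e0; apply: filterS => n; apply: le_lt_trans.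
  by rewrite [leRHS]ger0_norm ?mulr_ge0//; exact: cauchy_schwarz.
apply/subr_cvg0.
rewrite [F in F @ _](_ : _ = (fun n => inner (x n - l) (y n) : C) \+
    (fun n => inner l (y n - m) : C)); last first.
  by apply/funext => n /=; rewrite innerBl innerBr; ring.
by rewrite -[X in _ --> X]addr0; exact: cvgD.
Qed.

End limits.

Section limits_of_inner_products.
Context {R : realType}.
Implicit Types H K : hilbertType R.

Lemma inner_lim_eq H K (x : nat -> H) (l a : H) (y : nat -> K) (m b : K) :
  x @ \oo --> l -> y @ \oo --> m ->
  (forall n, inner (x n) a = inner (y n) b) -> inner l a = inner m b.
Proof.
move=> xl ym h.
have := @cvg_unique (complex R)^o (@norm_hausdorff _ _) _ _ _ _
  (cvg_inner xl (cvg_cst a)).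
apply; rewrite [F in F @ _](_ : _ = (fun n => inner (y n) b)).
  exact: (cvg_inner ym (cvg_cst b)).
exact/funext.
Qed.

(** Carries an adjunction <T_n x, y> = <x, T_n' y> over to pointwise limits. *)
Lemma inner_lim_adj H K (x : nat -> H) (l a : H) (y : nat -> K) (m b : K) :
  x @ \oo --> l -> y @ \oo --> m ->
  (forall n, inner (x n) a = inner b (y n)) -> inner l a = inner b m.
Proof.
move=> xl ym h; rewrite [RHS]innerC.
have := @cvg_unique (complex R)^o (@norm_hausdorff _ _) _ _ _ _
  (cvg_inner xl (cvg_cst a)).
apply; rewrite [F in F @ _](_ : _ = (fun n => Num.conj (inner (y n) b))).
  rewrite -(innerC b m).
  rewrite [F in F @ _](_ : _ = (fun n => inner b (y n))).
    exact: (cvg_inner (cvg_cst b) ym).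
  by apply/funext => n; rewrite -innerC.
by apply/funext => n; rewrite h -innerC.
Qed.

Lemma hnorm_sub_le H (x y : H) : `|hnorm x - hnorm y| <= hnorm (x - y).
Proof.
rewrite ler_norml; apply/andP; split.
  rewrite lerNl opprB lerBlDr -(hnorm_opp (x - y)) opprB.
  by apply: le_trans (ler_hnormD _ _); rewrite subrK.
by rewrite lerBlDr; apply: le_trans (ler_hnormD _ _); rewrite subrK.
Qed.

Lemma cvg_hnorm H (x : nat -> H) (l : H) :
  x @ \oo --> l -> (fun n => hnorm (x n)) @ \oo --> hnorm l.
Proof.
move=> /cvg_hnormP h; apply/cvgrPdist_lt => e /h; apply: filterS => n.
exact: le_lt_trans (hnorm_sub_le _ _).
Qed.

Lemma cvg_bounded_linear H K (T : H -> K) (M : R) (x : nat -> H) (l : H) :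
  (forall u v, T (u - v) = T u - T v) ->
  (forall u, hnorm (T u) <= M * hnorm u) ->
  x @ \oo --> l -> (fun n => T (x n)) @ \oo --> T l.
Proof.
move=> TB TM /cvg_hnormP h; apply/cvg_hnormP => e e0.
have M0 : 0 < `|M| + 1 by rewrite ltr_pwDr.
have /h : 0 < e / (`|M| + 1) by rewrite divr_gt0.
apply: filterS => n; rewrite ltr_pdivlMr// mulrC; apply: le_lt_trans.
rewrite -TB; apply: le_trans (TM _) _; rewrite ler_wpM2r ?hnorm_ge0//.
by rewrite (le_trans (ler_norm _))// lerDl.
Qed.

Lemma hnorm_le_of_sqr H (p : H) (M : R) : 0 <= M ->
  hnorm p ^+ 2 <= M * hnorm p -> hnorm p <= M.
Proof.
move=> M0; have := hnorm_ge0 p; rewrite le_eqVlt => /predU1P[<-//|p0].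
by rewrite expr2 ler_pM2r.
Qed.

Lemma sqr_hnorm_le H K (x y : K) (p : H) :
  inner x y = inner p p -> hnorm p ^+ 2 <= hnorm x * hnorm y.
Proof.
move=> xy; rewrite -lecR hnorm2 -xy rmorphM /= !hnormE.
apply: le_trans (cauchy_schwarz _ _).
by rewrite xy innerxx normrX normr_id.
Qed.

(** The hypothesis makes [p] orthogonal to [x - p], so [p] is a projection of [x]; Cauchy-Schwarz
    gives |p|^2 <= |x| |p|. *)
Lemma hnorm_proj_le H (x p : H) : inner x p = inner p p -> hnorm p <= hnorm x.
Proof. by move=> /sqr_hnorm_le; apply: hnorm_le_of_sqr; exact: hnorm_ge0. Qed.

End limits_of_inner_products.

(** * Series of pairwise orthogonal vectors *)

Section orthogonal_series.
Context {R : realType} {H : hilbertType R}.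
Implicit Types x : nat -> H.

Definition orthogonal_seq x := forall m n, m <> n -> inner (x m) (x n) = 0.

Lemma hnorm2_sum x (r : seq nat) : orthogonal_seq x -> uniq r ->
  hnorm (\sum_(k <- r) x k) ^+ 2 = \sum_(k <- r) hnorm (x k) ^+ 2.
Proof.
move=> xo ur; apply: (@complexI R); rewrite rmorph_sum /= hnorm2 inner_suml.
apply: eq_big_seq => k kr; rewrite inner_sumr hnorm2.
rewrite (bigD1_seq k)//= big1_seq ?addr0// => j /andP[jk _].
by apply: xo => kj; rewrite kj eqxx in jk.
Qed.

(** By Pythagoras the squared norm of a block of the series is an increment of the real series of
    squared norms, which is monotone and bounded, hence Cauchy. *)
Lemma cvg_orthogonal_series x (B : R) : orthogonal_seq x ->
  (forall n, \sum_(0 <= k < n) hnorm (x k) ^+ 2 <= B) ->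
  cvg (series x @ \oo).
Proof.
move=> xo xB; apply: cvg_hcauchy => e e0.
pose s : nat -> R := series (fun k => hnorm (x k) ^+ 2).
have s_cvg : cvgn s.
  apply: nondecreasing_is_cvgn; last by exists B => _ [n _ <-]; exact: xB.
  by apply: nondecreasing_series => k _ _; rewrite exprn_ge0 ?hnorm_ge0.
(* Two partial sums within [e ^+ 2 / 2] of the limit differ by less than [e ^+ 2], the square of the
   required bound. *)
have /cvgrPdist_lt/(_ (e ^+ 2 / 2)) : s @ \oo --> lim (s @ \oo) := s_cvg.
case=> [|N _ hN]; first by rewrite divr_gt0 ?exprn_gt0.
exists N => m n /andP[Nm mn].
rewrite -(@ltr_pXn2r _ 2) ?nnegrE ?hnorm_ge0 ?(ltW e0)//.
rewrite sub_series_geq// hnorm2_sum ?iota_uniq//.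
rewrite -[ltLHS](sub_series_geq (fun k => hnorm (x k) ^+ 2) mn) -/s.
have := hN m Nm; have := hN n (leq_trans Nm mn); rewrite /= -/(s _).
rewrite !ltr_norml => /andP[h1 h2] /andP[h3 h4].
lra.
Qed.

Lemma cvg_series_hnorm2 x (l : H) : orthogonal_seq x ->
  series x @ \oo --> l ->
  series (fun k => hnorm (x k) ^+ 2) @ \oo --> hnorm l ^+ 2.
Proof.
move=> xo xl; rewrite [F in F @ _](_ : _ = (fun n => hnorm (series x n) ^+ 2)).
  by apply: cvgM; exact: cvg_hnorm.
by apply/funext => n; rewrite /series /= hnorm2_sum ?iota_uniq.
Qed.

End orthogonal_series.

(** * Adjoint pairs of operators *)

Section adjoint_pair.
Context {R : realType}.
Implicit Types H K L : hilbertType R.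

(** A relation between bare functions: having an adjoint already forces linearity, so operators need
    not be bundled. *)
Definition adj H K (T : H -> K) (T' : K -> H) :=
  forall x y, inner (T x) y = inner x (T' y).

Lemma adj_sym H K (T : H -> K) T' : adj T T' -> adj T' T.
Proof. by move=> h x y; rewrite innerC -h -innerC. Qed.

Lemma adj_linear H K (T : H -> K) T' : adj T T' -> linear T.
Proof.
move=> h a x y; apply: eq_inner => z.
by rewrite h !innerDl !innerZl !h.
Qed.

Lemma adj_linB H K (T : H -> K) T' x y : adj T T' -> T (x - y) = T x - T y.
Proof. by move=> h; apply: eq_inner => z; rewrite h !innerBl !h. Qed.

Lemma adj_linD H K (T : H -> K) T' x y : adj T T' -> T (x + y) = T x + T y.
Proof. by move=> h; apply: eq_inner => z; rewrite h !innerDl !h. Qed.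

Lemma adj_linZ H K (T : H -> K) T' a x : adj T T' -> T (a *: x) = a *: T x.
Proof. by move=> h; apply: eq_inner => z; rewrite h !innerZl !h. Qed.

Lemma adj_lin0 H K (T : H -> K) T' : adj T T' -> T 0 = 0.
Proof. by move=> h; apply: eq_inner => z; rewrite h !inner0l. Qed.

Lemma adj_comp H K L (T : H -> K) T' (S : K -> L) S' :
  adj T T' -> adj S S' -> adj (S \o T) (T' \o S').
Proof. by move=> hT hS x y /=; rewrite hS hT. Qed.

(** The set behind [get] is inhabited by [T'], and definiteness makes its member unique. *)
Lemma adjE H K (T : bounded_operator H K) T' : adj T T' -> adjoint T = T'.
Proof.
move=> h; have : [set S : K -> H | forall f g, inner (T f) g = inner f (S g)] (adjoint T).
  by apply: getPex; exists T'.
move=> /= h2; apply/funext => y; apply: eq_inner => x.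
by rewrite innerC -h2 h -innerC.
Qed.

Lemma adj_isometry H K (T : H -> K) T' x : adj T T' -> T' (T x) = x ->
  hnorm (T x) = hnorm x.
Proof. by move=> h hx; apply: eq_hnorm; rewrite h hx. Qed.

End adjoint_pair.

(** * Orthonormal bases of separable spaces, and operators defined through them *)

Section orthobasis.
Context {R : realType}.
Implicit Types H K : hilbertType R.

Definition total_seq H I (e : I -> H) :=
  forall x, (forall i, inner x (e i) = 0) -> x = 0.

Lemma separable_dense_seq H : separable_space H ->
  exists d : nat -> H, forall x (eps : R), 0 < eps -> exists n, hnorm (x - d n) < eps.
Proof.
case=> D /countable_injP[f finj] dD.
(* Naturals that code no point of [D] get the value 0, which is harmless for density. *)
pose d n := xget 0 [set x | D x /\ f x = n].
exists d => x eps eps0.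
have eps0' : 0 < eps%:C%C by rewrite ltcR.
have [|y [yB Dy]] := dD _ _ (@open_interior _ (ball x eps%:C%C)).
  by exists x; exact: nbhsx_ballx.
exists (f y); rewrite /d; case: xgetP => [z _ [Dz fz]|/(_ y) []//].
have -> : z = y by apply: finj; rewrite ?inE.
by move/interior_subset : yB; rewrite -ball_normE /= -hnormE ltcR.
Qed.

(* When d lies in the span of s the result is 0, because |0|^-1 *: 0 = 0: the
   sequence below consists of unit vectors and zeros. *)
Definition gs_step H (s : seq H) (d : H) : H :=
  let r := d - \sum_(v <- s) inner d v *: v in
  (`|r|^-1) *: r.

Fixpoint gs_seq H (d : nat -> H) n : seq H :=
  if n is m.+1 then rcons (gs_seq d m) (gs_step (gs_seq d m) (d m)) else [::].

(** Totality comes from density: each [d n] is a combination of the [e k], so a vector orthogonal to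
    all [e k] is orthogonal to a dense sequence. *)
Lemma gram_schmidt H : separable_space H ->
  exists e : nat -> H, [/\ orthogonal_seq e,
    forall n, inner (e n) (e n) = 1 \/ e n = 0 & total_seq e].
Proof.
move=> /separable_dense_seq[d dd].
pose e n := gs_step (gs_seq d n) (d n).
have gsE n : gs_seq d n = [seq e k | k <- iota 0 n].
  elim: n => [//|n IH]; rewrite [LHS]/= -/(e n) IH -addn1 iotaD map_cat /= add0n.
  by rewrite cats1.
pose r n := d n - \sum_(0 <= k < n) inner (d n) (e k) *: e k.
have eE n : e n = `|r n|^-1 *: r n.
  by rewrite /e /gs_step gsE big_map /r /index_iota subn0.
have e01 n : inner (e n) (e n) = 1 \/ e n = 0.
  have [r0|r0] := eqVneq (r n) 0; [right|left]; first by rewrite eE r0 scaler0.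
  rewrite innerxx eE normrZ ger0_norm ?invr_ge0// mulVf ?expr1n//.
  by rewrite normr_eq0.
have ere n : r n = `|r n| *: e n.
  have [r0|r0] := eqVneq (r n) 0; first by rewrite r0 normr0 scale0r.
  by rewrite eE scalerA divff ?scale1r// normr_eq0.
have rE n : r n = d n - \sum_(0 <= k < n) inner (d n) (e k) *: e k by [].
clearbody r e.
have elt n : forall j, (j < n)%N -> inner (e n) (e j) = 0.
  elim/ltn_ind: n => n IH j jn.
  rewrite eE innerZl (_ : inner (r n) (e j) = 0) ?mulr0//.
  rewrite rE innerBl inner_suml (bigD1_seq j) ?iota_uniq//=; last first.
    by rewrite mem_index_iota.
  rewrite big1_seq ?addr0.
    by rewrite innerZl; case: (e01 j) => ->; rewrite ?inner0r ?mulr1 ?mulr0 subrr.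
  move=> k /andP[kj]; rewrite mem_index_iota /= => kn; rewrite innerZl.
  case: (ltngtP k j) kj => // kj _; last first.
    by rewrite (IH k kn j kj) mulr0.
  by rewrite (innerC0 (IH j jn k kj)) mulr0.
exists e; split => //.
  move=> m n; case: (ltngtP m n) => // mn _; last exact: elt.
  by apply/innerC0/elt.
move=> x xe; have xd n : inner x (d n) = 0.
  have -> : d n = r n + \sum_(0 <= k < n) inner (d n) (e k) *: e k by rewrite rE subrK.
  rewrite ere innerDr inner_sumr big1 ?addr0 ?innerZr ?xe ?mulr0// => k _.
  by rewrite innerZr xe mulr0.
apply: hnorm_eq0; apply/eqP/negPn/negP => x0.
have x0' : 0 < hnorm x by rewrite lt_neqAle eq_sym x0 hnorm_ge0.
(* With |x - d_n| < |x|, the identity |x|^2 = <x, x - d_n> contradicts Cauchy-Schwarz. *)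
have [n] := dd x _ x0'; apply/negP; rewrite -leNgt -(ler_pM2l x0') -expr2.
rewrite -lecR hnorm2 rmorphM /= !hnormE.
have -> : inner x x = inner x (x - d n) by rewrite innerBr xd subr0.
apply: le_trans (cauchy_schwarz _ _).
by rewrite innerBr xd subr0 innerxx normrX normr_id.
Qed.

(** The partial sum is the orthogonal projection of [x] onto the span of the first [n] vectors. *)
Lemma bessel H (e : nat -> H) x n : orthogonal_seq e ->
  (forall n, inner (e n) (e n) = 1 \/ e n = 0) ->
  hnorm (\sum_(0 <= k < n) inner x (e k) *: e k) <= hnorm x.
Proof.
move=> eo e01; apply: hnorm_proj_le.
rewrite inner_suml inner_sumr; apply: eq_big_seq => k kn.
rewrite innerZr innerZl inner_sumr (bigD1_seq k) ?iota_uniq//=.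
rewrite big1_seq ?addr0.
  rewrite innerZr; case: (e01 k) => ->; last by rewrite !inner0r !mulr0.
  by rewrite mulr1 mulrC.
by move=> j /andP[jk _]; rewrite innerZr eo ?mulr0// => kj; rewrite kj eqxx in jk.
Qed.

Lemma orthogonal_seqZ H (e : nat -> H) (c : nat -> complex R) :
  orthogonal_seq e -> orthogonal_seq (fun k => c k *: e k).
Proof. by move=> eo m n mn; rewrite innerZl innerZr eo ?mulr0. Qed.

Lemma hnormZ_eq H K (c : complex R) (x : H) (y : K) :
  inner x x = inner y y -> hnorm (c *: x) = hnorm (c *: y).
Proof. by move=> /eq_hnorm h; rewrite !hnormZ h. Qed.

(** The terms have the same norms as those of the expansion of [x] in [e], so Bessel bounds their
    squares. *)
Lemma cvg_transfer H K (e : nat -> H) (u : nat -> K) x :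
  orthogonal_seq e -> orthogonal_seq u ->
  (forall n, inner (e n) (e n) = 1 \/ e n = 0) ->
  (forall n, inner (u n) (u n) = inner (e n) (e n)) ->
  cvg (series (fun k => inner x (e k) *: u k) @ \oo).
Proof.
move=> eo uo e01 ue; apply: (@cvg_orthogonal_series _ _ _ (hnorm x ^+ 2)).
  exact: orthogonal_seqZ.
move=> n; under eq_bigr do rewrite (hnormZ_eq _ (ue _)).
rewrite -(hnorm2_sum (orthogonal_seqZ _ eo)) ?iota_uniq//.
by rewrite ler_pXn2r ?nnegrE ?hnorm_ge0// bessel.
Qed.

(** For orthogonal families of units and zeros with matching norms, this is the partial isometry
    taking [e n] to [u n] and vanishing on the orthogonal complement of [e]. *)
Definition transfer H K (e : nat -> H) (u : nat -> K) x : K :=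
  lim (series (fun k => inner x (e k) *: u k) @ \oo).

Section transfer.
Context {H K : hilbertType R} (e : nat -> H) (u : nat -> K).
Hypotheses (eo : orthogonal_seq e) (uo : orthogonal_seq u).
Hypothesis e01 : forall n, inner (e n) (e n) = 1 \/ e n = 0.
Hypothesis ue : forall n, inner (u n) (u n) = inner (e n) (e n).

Lemma unit_or0_transfer n : inner (u n) (u n) = 1 \/ u n = 0.
Proof.
case: (e01 n) => en; [left|right]; first by rewrite ue.
by apply: inner_eq0; rewrite ue en inner0l.
Qed.

(** On partial sums both sides equal the sum of <x, e_k> <u_k, y>. *)
Lemma transfer_adj : adj (transfer e u) (transfer u e).
Proof.
move=> x y; apply: inner_lim_adj.
- exact: (@cvg_transfer H K).
- by apply: (@cvg_transfer K H) => //; exact: unit_or0_transfer.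
move=> n; rewrite inner_suml inner_sumr; apply: eq_bigr => k _.
by rewrite innerZl innerZr -innerC mulrC.
Qed.

End transfer.

Lemma transfer_basis H K (e : nat -> H) (u : nat -> K) n :
  orthogonal_seq e ->
  (forall n, inner (e n) (e n) = 1 \/ e n = 0) ->
  (forall n, inner (u n) (u n) = inner (e n) (e n)) ->
  transfer e u (e n) = u n.
Proof.
move=> eo e01 ue; apply: cvg_lim => //.
apply: cvg_near_cst; exists n.+1 => // N /= nN.
rewrite /series /= (bigD1_seq n) ?iota_uniq ?mem_index_iota//=.
rewrite big1_seq ?addr0.
  have [->|en] := e01 n; first by rewrite scale1r.
  have -> : u n = 0 by apply: inner_eq0; rewrite ue en inner0l.
  by rewrite scaler0.
by move=> j /andP[jn _]; rewrite eo ?scale0r// => kj; rewrite kj eqxx in jn.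
Qed.

(** By adjointness both sides have the same inner product with every [e n]; totality concludes. *)
Lemma transferK H K (e : nat -> H) (u : nat -> K) x :
  orthogonal_seq e -> orthogonal_seq u ->
  (forall n, inner (e n) (e n) = 1 \/ e n = 0) ->
  (forall n, inner (u n) (u n) = inner (e n) (e n)) -> total_seq e ->
  transfer u e (transfer e u x) = x.
Proof.
move=> eo uo e01 ue et; apply/eqP; rewrite -subr_eq0; apply/eqP/et => n.
have uu := unit_or0_transfer e01 ue.
rewrite innerBl (transfer_adj uo eo)// (transfer_adj eo uo)//.
by rewrite !transfer_basis// subrr.
Qed.

Lemma cvg_basis H (e : nat -> H) x : orthogonal_seq e ->
  (forall n, inner (e n) (e n) = 1 \/ e n = 0) -> total_seq e ->
  series (fun k => inner x (e k) *: e k) @ \oo --> x.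
Proof.
move=> eo e01 et.
suff {2}-> : x = transfer e e x by exact: (@cvg_transfer H H).
apply/eqP; rewrite -subr_eq0; apply/eqP/et => n.
by rewrite innerBl (transfer_adj eo eo)// transfer_basis// subrr.
Qed.

(** The adjoint is written down as the sum of <g, T e_k> e_k; the adjunction follows by expanding
    [x] in [e] and using continuity of [T]. *)
Lemma adj_exists H K (T : H -> K) (M : R) : separable_space H -> linear T ->
  (forall x, hnorm (T x) <= M * hnorm x) -> exists T', adj T T'.
Proof.
move=> /gram_schmidt[e [eo e01 et]] Tlin TM.
pose L := GRing.isLinear.Build _ _ _ _ T Tlin.
pose Tl : {linear H -> K} := HB.pack T L.
have TZ a x : T (a *: x) = a *: T x by exact: (linearZ_LR Tl).
have T0 : T 0 = 0 by exact: (linear0 Tl).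
have Tsum (F : nat -> H) n : T (\sum_(0 <= k < n) F k) = \sum_(0 <= k < n) T (F k).
  by exact: (linear_sum Tl).
have c_cvg g : cvg (series (fun k => inner g (T (e k)) *: e k) @ \oo).
  apply: (@cvg_orthogonal_series _ _ _ ((hnorm g * `|M|) ^+ 2)).
    exact: orthogonal_seqZ.
  move=> n; rewrite -(hnorm2_sum (orthogonal_seqZ _ eo)) ?iota_uniq//.
  rewrite ler_pXn2r ?nnegrE ?hnorm_ge0 ?mulr_ge0 ?hnorm_ge0//.
  set p := \sum_(_ <- _) _.
  (* This yields |p|^2 <= |g| |M| |p|, hence a bound on the partial sums independent of [n]. *)
  have pp : inner g (T p) = inner p p.
    rewrite Tsum inner_sumr [RHS]inner_suml.
    apply: eq_big_seq => k kn.
    rewrite TZ innerZl innerZr inner_sumr (bigD1_seq k) ?iota_uniq//=.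
    rewrite big1_seq ?addr0.
      rewrite innerZr; case: (e01 k) => ->; first by rewrite mulr1 mulrC.
      by rewrite T0 !inner0r !mulr0 ?mul0r.
    by move=> j /andP[jk _]; rewrite innerZr eo ?mulr0// => kj; rewrite kj eqxx in jk.
  apply: hnorm_le_of_sqr; first by rewrite mulr_ge0 ?hnorm_ge0.
  apply: le_trans (sqr_hnorm_le pp) _; rewrite -mulrA ler_wpM2l ?hnorm_ge0//.
  by apply: le_trans (TM _) _; rewrite ler_wpM2r ?hnorm_ge0// ler_norm.
exists (fun g => lim (series (fun k => inner g (T (e k)) *: e k) @ \oo)).
move=> x y.
have xl := @cvg_basis _ e x eo e01 et.
have Txl := @cvg_bounded_linear _ _ _ T M _ _ (linearB Tl) TM xl.
apply: inner_lim_adj Txl (c_cvg y) _ => n.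
rewrite Tsum inner_suml inner_sumr; apply: eq_bigr => k _.
by rewrite TZ innerZl innerZr -innerC mulrC.
Qed.

End orthobasis.

(** * A self-adjoint solution of Y + Y^2 = D (1 + 3 (Y + Y^2)) by iteration *)

Section selfadjoint_root.
Context {R : realType} {H : hilbertType R}.
Local Notation C := (complex R).
Variable D : H -> H.
Hypothesis DD : adj D D.
Hypothesis D_small : forall x, hnorm (D x) <= 50^-1 * hnorm x.

(* With P = 1 + 3 (Y + Y^2), a fixed point Y satisfies Y + Y^2 = D P, hence
   (1 - 3 D) P = 1. *)
Definition root_step (A : H -> H) (x : H) : H :=
  D (x + (3 : C) *: (A x + A (A x))) - A (A x).

Definition root_iter n : H -> H := iter n root_step (fun=> 0).

Lemma hnormZn n (x : H) : hnorm ((n%:R : C) *: x) = n%:R * hnorm x.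
Proof. by rewrite -(rmorph_nat (real_complex R)) hnormZr ger0_norm. Qed.

Lemma innerZnr n (x y : H) : inner x ((n%:R : C) *: y) = n%:R * inner x y.
Proof. by rewrite innerZr; congr (_ * _); exact: conjC_nat. Qed.

(** The bound 1/10 is preserved because 1/50 (1 + 3 (1/10 + 1/100)) + 1/100 < 1/10. *)
Lemma root_step_bound A : (forall x, hnorm (A x) <= 10^-1 * hnorm x) ->
  forall x, hnorm (root_step A x) <= 10^-1 * hnorm x.
Proof.
move=> hA x; rewrite /root_step.
have h1 := hA x; have h2 := hA (A x).
have h3 := ler_hnormB (D (x + (3 : C) *: (A x + A (A x)))) (A (A x)).
have h4 := D_small (x + (3 : C) *: (A x + A (A x))).
have h5 := ler_hnormD x ((3 : C) *: (A x + A (A x))).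
have h6 := ler_hnormD (A x) (A (A x)).
rewrite hnormZn in h5.
have := hnorm_ge0 x.
lra.
Qed.

(** Squaring has Lipschitz constant 1/5 on operators of norm at most 1/10, so the step has constant
    at most 3/50 (1 + 1/5) + 1/5 < 1/2. *)
Lemma root_step_lipschitz A B (del : R) : adj A A -> adj B B ->
  (forall x, hnorm (A x) <= 10^-1 * hnorm x) ->
  (forall x, hnorm (B x) <= 10^-1 * hnorm x) -> 0 <= del ->
  (forall x, hnorm (A x - B x) <= del * hnorm x) ->
  forall x, hnorm (root_step A x - root_step B x) <= del / 2 * hnorm x.
Proof.
move=> AA BB hA hB del0 hAB x.
set a := A x - B x; set b := A (A x) - B (B x).
have -> : root_step A x - root_step B x = D ((3 : C) *: (a + b)) - b.
  rewrite /root_step /b /a; apply: eq_inner => w.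
  by rewrite !(innerDl, innerNl, DD, innerZl); ring.
have ha : hnorm a <= del * hnorm x by exact: hAB.
have hb : hnorm b <= 5^-1 * del * hnorm x.
  have -> : b = A a + (A (B x) - B (B x)).
    by rewrite /b /a (adj_linB _ _ AA) addrA subrK.
  have h1 := ler_hnormD (A a) (A (B x) - B (B x)); have h2 := hA a.
  have h3 := hAB (B x).
  have h4 : del * hnorm (B x) <= del * (10^-1 * hnorm x) by rewrite ler_wpM2l.
  have h5 := hnorm_ge0 x.
  lra.
have h1 := ler_hnormB (D ((3 : C) *: (a + b))) b.
have h2 := D_small ((3 : C) *: (a + b)); rewrite hnormZn in h2.
have h3 := ler_hnormD a b.
have h5 := hnorm_ge0 x.
have : 0 <= del * hnorm x by rewrite mulr_ge0.
lra.
Qed.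

Lemma root_iter_bound n x : hnorm (root_iter n x) <= 10^-1 * hnorm x.
Proof.
elim: n x => [|n IH] x; last exact: root_step_bound.
by rewrite /root_iter /= hnorm0 mulr_ge0 ?hnorm_ge0.
Qed.

(** The iterates are polynomials in [D]. Both properties go through one induction, since
    self-adjointness of a product of [D] and [A] relies on their commuting. *)
Lemma root_iter_adj_comm n :
  adj (root_iter n) (root_iter n) /\ forall x, root_iter n (D x) = D (root_iter n x).
Proof.
elim: n => [|n [IH1 IH2]].
  split=> [x y|x]; first by rewrite /root_iter /= inner0l inner0r.
  by rewrite /root_iter /= (adj_lin0 DD).
rewrite /root_iter iterS -/(root_iter n); move: IH1 IH2.
set A := root_iter n => AA AD.
split=> [x y|x]; rewrite /root_step.
  rewrite !(adj_linD _ _ DD) !(adj_linZ _ _ DD) !(adj_linD _ _ DD).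
  by rewrite !(innerDl, innerDr, innerNl, innerNr, DD, AA, innerZl, innerZnr, AD).
by rewrite !AD (adj_linB _ _ DD) !(adj_linD _ _ DD) !(adj_linZ _ _ DD) !(adj_linD _ _ DD).
Qed.

Lemma root_iter_step n x :
  hnorm (root_iter n.+1 x - root_iter n x) <= 10^-1 * 2^-1 ^+ n * hnorm x.
Proof.
elim: n x => [|n IH] x.
  by rewrite expr0 mulr1 subr0; exact: root_iter_bound.
rewrite exprSr mulrA; apply: (@root_step_lipschitz (root_iter n.+1) (root_iter n)) => //.
- by case: (root_iter_adj_comm n.+1).
- by case: (root_iter_adj_comm n).
- exact: root_iter_bound.
- exact: root_iter_bound.
Qed.

Lemma root_iter_cauchy m n x : (m <= n)%N ->
  hnorm (root_iter n x - root_iter m x) <= 2^-1 ^+ m * hnorm x.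
Proof.
move=> mn.
(* The right side is the closed form of the geometric sum of the step bounds from [m] to [n - 1];
   keeping the term in [n] makes the induction work. *)
suff : hnorm (root_iter n x - root_iter m x) <=
   5^-1 * (2^-1 ^+ m - 2^-1 ^+ n) * hnorm x.
  have h1 : 0 <= 2^-1 ^+ m * hnorm x by rewrite mulr_ge0 ?exprn_ge0 ?hnorm_ge0.
  have h2 : 0 <= 2^-1 ^+ n * hnorm x by rewrite mulr_ge0 ?exprn_ge0 ?hnorm_ge0.
  lra.
rewrite -(subnK mn); elim: (n - m)%N => [|k IH].
  by rewrite !subrr hnorm0 mulr0 mul0r.
rewrite addSn; have h := root_iter_step (k + m) x.
have := ler_hnormD (root_iter (k + m).+1 x - root_iter (k + m) x)
  (root_iter (k + m) x - root_iter m x).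
rewrite addrA subrK exprS.
lra.
Qed.

Definition root_op x := lim (root_iter ^~ x @ \oo).

Lemma root_iter_cvg x : root_iter ^~ x @ \oo --> root_op x.
Proof.
apply: cvg_hcauchy => e e0.
have h : (fun n => 2^-1 ^+ n * hnorm x) @ \oo --> (0 : R).
  rewrite -(mul0r (hnorm x)); apply: cvgMl.
  by apply: cvg_expr; rewrite ger0_norm// invf_lt1 ?ltr1n.
have /cvgrPdist_lt/(_ e e0)[N _ hN] := h.
exists N => m n /andP[Nm mn].
apply: le_lt_trans (root_iter_cauchy _ mn) _.
have := hN m Nm; rewrite /= sub0r normrN ger0_norm//.
by rewrite mulr_ge0 ?exprn_ge0 ?hnorm_ge0.
Qed.

Lemma root_op_adj : adj root_op root_op.
Proof.
move=> x y; apply: inner_lim_adj (@root_iter_cvg x) (@root_iter_cvg y) _ => n.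
by case: (root_iter_adj_comm n).
Qed.

Lemma root_op_comm x : root_op (D x) = D (root_op x).
Proof.
apply: eq_inner => y; rewrite DD.
apply: inner_lim_eq (@root_iter_cvg _) (@root_iter_cvg _) _ => n.
by case: (root_iter_adj_comm n) => _ ->; rewrite DD.
Qed.

(* Strong convergence of the self-adjoint iterates suffices: the quadratic terms
   are tested weakly, <Y_n Y_n x, y> = <Y_n x, Y_n y>. *)
Lemma root_op_eq x : root_op x + root_op (root_op x) =
  D (x + (3 : C) *: (root_op x + root_op (root_op x))).
Proof.
apply: eq_inner => y.
have cx := @root_iter_cvg x; have cy := @root_iter_cvg y.
have cD := @root_iter_cvg (D y).
have c1 := cvg_inner cx cy; have c2 := cvg_inner cx cD.
have cst (z : H) : (fun _ : nat => z) @ \oo --> z by exact: cvg_cst.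
have c3 := cvg_inner cx (cst (D y)).
have FF : Filter (nbhs (\oo : set_system nat)) by exact: _.
(* [d], [d3] and [d4] assemble the limit of <root_step Y_n x, y>; uniqueness of limits equates it
   with that of [c5]. *)
have d := @cvgD _ C^o _ \oo FF _ _ _ _ c3 c2.
have d3 := @cvgD _ C^o _ \oo FF _ _ _ _ (@cvgD _ C^o _ \oo FF _ _ _ _ d d) d.
have d4 := @cvgB _ C^o _ \oo FF _ _ _ _
  (@cvgD _ C^o _ \oo FF _ _ _ _ (cvg_inner (cst x) (cst (D y))) d3) c1.
have cS : (fun n => root_iter n.+1 x) @ \oo --> root_op x.
  by move: cx; rewrite -(cvg_shiftS (root_iter ^~ x)).
have c5 := cvg_inner cS (cst y).
rewrite [F in F @ _ --> _](_ : _ = (fun n => inner (root_iter n.+1 x) y)) in d4; last first.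
  apply/funext => n; have [Ya _] := root_iter_adj_comm n.
  transitivity (inner (root_step (root_iter n) x) y) => //.
  by rewrite /root_step innerBl DD !fctE /= !(innerDl, innerZl) !Ya; ring.
have e := @cvg_unique C^o (@norm_hausdorff _ _) _ _ _ _ c5 d4.
have {}e : inner (root_op x) y = inner x (D y) +
   3 * (inner (root_op x) (D y) + inner (root_op x) (root_op (D y))) -
   inner (root_op x) (root_op y) by rewrite [LHS]e; ring.
by rewrite DD !(innerDl, innerZl) e !root_op_adj; ring.
Qed.

End selfadjoint_root.

(** * Unitary operators, and 1 + S as a sum of two of them *)

Section unitary.
Context {R : realType} {H : hilbertType R}.
Local Notation C := (complex R).

Definition unitary (U U' : H -> H) := [/\ adj U U', cancel U U' & cancel U' U].

Lemma adj_bound (T T' : H -> H) (M : R) : adj T T' -> 0 <= M ->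
  (forall x, hnorm (T x) <= M * hnorm x) -> forall x, hnorm (T' x) <= M * hnorm x.
Proof.
move=> TT M0 TM x; apply: hnorm_le_of_sqr; first by rewrite mulr_ge0 ?hnorm_ge0.
apply: le_trans (sqr_hnorm_le (TT (T' x) x)) _.
by rewrite mulrAC ler_wpM2r ?hnorm_ge0.
Qed.

Lemma innerZVnr n (x y : H) : inner x ((n%:R^-1 : C) *: y) = n%:R^-1 * inner x y.
Proof.
rewrite innerZr; congr (_ * _).
by apply: etrans (fmorphV _ _) _; congr (_^-1); exact: conjC_nat.
Qed.

(** As [t] is imaginary, K (1 + t X) / 2 has adjoint (1 - t X) K' / 2. Moving [X] through K' K turns
    their product U' U into K' K (1 - t^2 X^2) / 4, which is 1 by hypothesis. *)
Lemma unitary_of_root (K K' X : H -> H) (t : C) : adj K K' -> adj X X ->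
  Num.conj t = - t ->
  (forall x, X (K' (K x)) = K' (K (X x))) ->
  (forall x, K' (K (x - t ^+ 2 *: X (X x))) = (4 : C) *: x) ->
  (forall x, K' x = 0 -> x = 0) ->
  unitary (fun x => (2^-1 : C) *: K (x + t *: X x))
          (fun x => (2^-1 : C) *: (K' x - t *: X (K' x))).
Proof.
move=> KK XX tt XK root K'0.
have KD x y := adj_linD x y KK; have KZ a x := adj_linZ a x KK.
have K'B x y := adj_linB x y (adj_sym KK); have K'Z a x := adj_linZ a x (adj_sym KK).
have K'D x y := adj_linD x y (adj_sym KK).
have KB x y := adj_linB x y KK.
have XD x y := adj_linD x y XX; have XB x y := adj_linB x y XX.
have XZ a x := adj_linZ a x XX.
have quarter (x : H) : (2^-1 : C) *: ((2^-1 : C) *: ((4 : C) *: x)) = x.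
  rewrite !scalerA (_ : _ * _ = 1) ?scale1r//.
  by rewrite -invfM -natrM mulVf// pnatr_eq0.
split=> [x y|x|y].
- rewrite innerZl KK innerDl innerZl XX innerZVnr innerBr innerZr tt.
  by rewrite mulNr opprK.
- rewrite K'Z XZ XK.
  rewrite [t *: (_ *: _)]scalerA [t * _]mulrC -[(_ * t) *: _]scalerA -scalerBr.
  rewrite -(K'Z t) -(KZ t) -K'B -KB.
  rewrite (_ : _ - _ = x - t ^+ 2 *: X (X x)) ?root ?quarter//.
  rewrite XD XZ scalerDr scalerA -expr2.
  by rewrite opprD addrA addrK.
- (* K' is injective, so it is enough to prove K' (U (U' y)) = K' y. *)
  apply/eqP; rewrite -subr_eq0; apply/eqP/K'0; rewrite K'B.
  set v := K' y; rewrite K'Z XZ.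
  rewrite [t *: (_ *: _)]scalerA [t * _]mulrC -[(_ * t) *: _]scalerA -scalerDr KZ K'Z.
  rewrite (_ : _ - _ + _ = v - t ^+ 2 *: X (X v)) ?root ?quarter ?subrr//.
  by rewrite XB XZ scalerBr scalerA -expr2 addrA subrK.
Qed.

Lemma sum_of_unitaries (S S' : H -> H) : adj S S' ->
  (forall x, hnorm (S x) <= 50^-1 * hnorm x) ->
  exists U1 U1' U2 U2', [/\ unitary U1 U1', unitary U2 U2' &
    forall x, x + S x = U1 x + U2 x].
Proof.
move=> SS Sb.
have S'b : forall x, hnorm (S' x) <= 50^-1 * hnorm x by apply: adj_bound SS _ Sb.
pose K x := x + S x; pose K' x := x + S' x.
have KK : adj K K' by move=> x y; rewrite innerDl SS innerDr.
have GG : adj (K' \o K) (K' \o K) by exact: adj_comp KK (adj_sym KK).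
pose D x := (3^-1 : C) *: (x - K' (K x)).
have DD : adj D D.
  by move=> x y; rewrite innerZl innerZVnr innerBl innerBr [inner (K' _) _]GG.
have Db x : hnorm (D x) <= 50^-1 * hnorm x.
  (* The three terms have norms at most 1/50, 1/50 and 1/2500 times |x|, in total below 3/50. *)
  have h : (3 : C) *: D x = - (S x + S' x + S' (S x)).
    rewrite scalerA divff ?pnatr_eq0// scale1r /K' /K (adj_linD _ _ (adj_sym SS)).
    by apply: eq_inner => w; rewrite !(innerDl, innerNl); ring.
  have : hnorm ((3 : C) *: D x) <= hnorm (S x) + hnorm (S' x) + hnorm (S' (S x)).
    rewrite h hnorm_opp; apply: le_trans (ler_hnormD _ _) _.
    by rewrite lerD2r ler_hnormD.
  rewrite hnormZn.
  have := Sb x; have := S'b x; have := S'b (S x); have := hnorm_ge0 x.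
  lra.
pose Y := root_op D.
have YY : adj Y Y := root_op_adj DD Db.
have YD x : Y (D x) = D (Y x) := root_op_comm DD Db x.
have Yeq x := root_op_eq DD Db x; rewrite -/Y in Yeq.
pose X x := x + (2 : C) *: Y x.
have XX : adj X X by move=> x y; rewrite innerDl innerDr innerZl innerZnr YY.
have GE x : K' (K x) = x - (3 : C) *: D x.
  by rewrite /D scalerA divff ?pnatr_eq0// scale1r opprB addrC subrK.
have XK x : X (K' (K x)) = K' (K (X x)).
  rewrite !GE /X (adj_linB _ _ YY) (adj_linZ _ _ YY) YD (adj_linD _ _ DD) (adj_linZ _ _ DD).
  by apply: eq_inner => w; rewrite !(innerDl, innerNl, innerZl); ring.
have root (t : C) : t ^+ 2 = - 3 ->
    forall x, K' (K (x - t ^+ 2 *: X (X x))) = (4 : C) *: x.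
  move=> t2 x.
  (* Here 1 + 3 X^2 = 4 P with P = 1 + 3 (Y + Y^2), and the equation of [Y] says (1 - 3 D) P = 1,
     where 1 - 3 D = K' K. *)
  have -> : x - t ^+ 2 *: X (X x) = (4 : C) *: (x + (3 : C) *: (Y x + Y (Y x))).
    rewrite t2 /X (adj_linD _ _ YY) (adj_linZ _ _ YY).
    by apply: eq_inner => w; rewrite !(innerDl, innerNl, innerZl); ring.
  rewrite GE (adj_linZ _ _ DD) -Yeq.
  by apply: eq_inner => w; rewrite !(innerDl, innerNl, innerZl); ring.
have K'0 x : K' x = 0 -> x = 0.
  (* K' x = 0 means x = - S' x, whose norm is at most |x| / 50. *)
  move=> /eqP; rewrite addr_eq0 => /eqP xS; apply: hnorm_eq0.
  have := S'b x; rewrite -hnorm_opp -xS; have := hnorm_ge0 x; lra.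
(* Both [t] and [- t] are imaginary with square -3; the terms in [X] cancel when the two unitaries
   are added, leaving [K]. *)
pose t : C := 'i * (Num.sqrt 3)%:C%C.
have t2 : t ^+ 2 = - 3.
  rewrite exprMn sqrCi mulN1r; congr (- _).
  by rewrite -rmorphXn /= sqr_sqrtr// rmorph_nat.
have tt : Num.conj t = - t.
  apply: etrans (rmorphM _ _ _) _; rewrite /t -mulNr; congr (_ * _); first exact: conjCi.
  by apply: conj_Creal; apply/complex_realP; exists (Num.sqrt 3).
have Nt2 : (- t) ^+ 2 = - 3 by rewrite sqrrN.
have Ntt : Num.conj (- t) = - - t by rewrite -[in RHS]tt; apply: rmorphN.
have u1 := unitary_of_root KK XX tt XK (root _ t2) K'0.
have u2 := unitary_of_root KK XX Ntt XK (root _ Nt2) K'0.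
do 4 eexists; split; [exact: u1|exact: u2|] => x.
rewrite -scalerDr -(adj_linD _ _ KK) scaleNr addrACA subrr addr0.
rewrite (_ : x + x = (2 : C) *: x); last by rewrite scaler_nat mulr2n.
by rewrite (adj_linZ _ _ KK) scalerA mulVf ?scale1r// pnatr_eq0.
Qed.

End unitary.

(** * Matching a basis of H with bases of the H_i *)

Section infinite_basis.
Context {R : realType} {H : hilbertType R}.

(** Zeros are dropped from a Gram-Schmidt sequence and the rest is renumbered; infinitely many
    vectors remain, since finitely many would span [H]. *)
Lemma infinite_orthonormal_basis : separable_space H -> infinite_dimensional H ->
  exists g : nat -> H,
    [/\ orthogonal_seq g, forall n, inner (g n) (g n) = 1 & total_seq g].
Proof.
move=> /gram_schmidt[e [eo e01 et]] Hinf.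
pose A := [set n | e n <> 0].
have Ainf : infinite_set A.
  move=> /finite_seqP[s As]; apply: Hinf.
  pose N := (\max_(i <- s) i).+1.
  have eN n : (N <= n)%N -> e n = 0.
    move=> Nn; apply: contrapT => en.
    have : n \in s by have : A n by []; rewrite As.
    by move=> /(@leq_bigmax_seq _ _ xpredT id)/(_ isT); rewrite leqNgt Nn.
  exists N, (fun k : 'I_N => e k) => x; exists (fun k => inner x (e k)).
  rewrite -(big_mkord xpredT (fun k => inner x (e k) *: e k)).
  apply/eqP; rewrite -subr_eq0; apply/eqP/et => n.
  have [nN|Nn] := ltnP n N; last by rewrite eN// inner0r.
  rewrite innerBl inner_suml (bigD1_seq n) ?iota_uniq ?mem_index_iota//=.
  rewrite big1_seq ?addr0.
    by rewrite innerZl; case: (e01 n) => ->; rewrite ?inner0r ?mulr1 ?mulr0 subrr.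
  move=> j /andP[jn _]; rewrite innerZl eo ?mulr0// => kj.
  by rewrite kj eqxx in jn.
have /card_esym/card_set_bijP[psi [psiA psiI psiS]] := eq_card_nat (countableP A) Ainf.
exists (e \o psi); split.
- by move=> m n mn; apply: eo => /psiI; rewrite !inE => /(_ I I).
- by move=> n; have := psiA n I; case: (e01 (psi n)).
move=> x xe; apply: et => n.
have [->|/eqP en] := eqVneq (e n) 0; first by rewrite inner0r.
by have [m _ <-] := psiS n en; exact: xe.
Qed.

End infinite_basis.

Section matched_basis.
Context {R : realType} {J : set int} {H : hilbertType R} {H_ : J -> hilbertType R}.
Local Notation C := (complex R).

(* Finitely many coordinates have a common nontrivial zero on the span of N + 1
   vectors of g, contradicting the injectivity of Lambda. *)
Lemma infinite_coordinates (Lambda : forall i : J, bounded_operator H (H_ i))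
    (e : forall i, nat -> H_ i) (g : nat -> H) :
  (forall i, total_seq (e i)) -> orthogonal_seq g ->
  (forall n, inner (g n) (g n) = 1) ->
  (forall f, (forall i, Lambda i f = 0) -> f = 0) ->
  infinite_set [set p : J * nat | e p.1 p.2 <> 0].
Proof.
move=> et go g1 Linj /finite_seqP[s sE].
pose N := size s; pose t : N.-tuple (J * nat) := in_tuple s.
(* Row [j] lists the coordinates of the images of [g j]; with more rows than columns, a nontrivial
   combination of rows vanishes. *)
pose M := \matrix_(j < N.+1, k < N)
  inner (Lambda (tnth t k).1 (g j)) (e (tnth t k).1 (tnth t k).2) : 'M[C]_(N.+1, N).
have : kermx M != 0.
  by rewrite -mxrank_eq0 mxrank_ker -lt0n subn_gt0 ltnS rank_leq_col.
move=> /rowV0Pn[v /sub_kermxP vM v0].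
pose f := \sum_(j < N.+1) v 0 j *: g j.
have f0 : f = 0.
  apply: Linj => i; apply: et => k.
  have [->|/eqP ek] := eqVneq (e i k) 0; first by rewrite inner0r.
  have : (i, k) \in s.
    by have : [set p : J * nat | e p.1 p.2 <> 0] (i, k) by []; rewrite sE.
  move=> /(tnthP t)[l lE].
  have := congr1 (fun A : 'rV_N => A 0 l) vM; rewrite !mxE => vM0; rewrite -[RHS]vM0.
  rewrite /f linear_sum inner_suml; apply: eq_bigr => j _.
  by rewrite linearZ /= innerZl mxE -lE.
move/eqP: v0; apply; apply/rowP => j; rewrite mxE.
have : inner f (g j) = 0 by rewrite f0 inner0l.
rewrite inner_suml (bigD1 j)//= big1 ?addr0 ?innerZl ?g1 ?mulr1// => k kj.
by rewrite innerZl go ?mulr0// => /ord_inj kj'; rewrite kj' eqxx in kj.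
Qed.

(** A bijection from the pairs with [e i k] nonzero to the naturals distributes [g] among the
    indices. Zeros are matched with zeros, so that norms agree as [transfer] requires. *)
Lemma matched_basis (e : forall i, nat -> H_ i) (g : nat -> H) :
  (forall i n, inner (e i n) (e i n) = 1 \/ e i n = 0) ->
  orthogonal_seq g -> (forall n, inner (g n) (g n) = 1) -> total_seq g ->
  infinite_set [set p : J * nat | e p.1 p.2 <> 0] ->
  exists u : J -> nat -> H, [/\
    forall i k j l, (i, k) <> (j, l) -> inner (u i k) (u j l) = 0,
    forall i k, inner (u i k) (u i k) = inner (e i k) (e i k) &
    forall x, (forall i k, inner x (u i k) = 0) -> x = 0].
Proof.
move=> e01 go g1 gt Pinf.
have /card_set_bijP[phi [_ phiI phiS]] := eq_card_nat (countableP _) Pinf.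
pose u i k := if e i k == 0 then 0 else g (phi (i, k)).
exists u; split.
- move=> i k j l ikjl; rewrite /u.
  case: eqP => [_|eik]; first by rewrite inner0l.
  case: eqP => [_|ejl]; first by rewrite inner0r.
  by apply: go => /phiI; rewrite !inE => /(_ eik ejl).
- move=> i k; rewrite /u; case: eqP => [->|eik]; first by rewrite !inner0l.
  by rewrite g1; case: (e01 i k).
move=> x xu; apply: gt => n; have [[i k] /= eik <-] := phiS n I.
by have := xu i k; rewrite /u; case: eqP.
Qed.

End matched_basis.

Lemma transfer_ortho {R : realType} {H K : hilbertType R} (e : nat -> H)
    (u : nat -> K) x z :
  orthogonal_seq e -> orthogonal_seq u ->
  (forall n, inner (e n) (e n) = 1 \/ e n = 0) ->
  (forall n, inner (u n) (u n) = inner (e n) (e n)) ->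
  (forall k, inner (u k) z = 0) -> inner (transfer e u x) z = 0.
Proof.
move=> eo uo e01 ue uz; rewrite -[RHS](inner0l z).
apply: inner_lim_eq; first exact: cvg_transfer.
  exact: (@cvg_cst K 0).
move=> n; rewrite inner0l inner_suml big1// => k _.
by rewrite innerZl uz mulr0.
Qed.

(** * Coordinate systems, synthesis and the Parseval identity *)

Section gcoordinates.
Context {R : realType} {J : set int} {H : hilbertType R} {H_ : J -> hilbertType R}.
Local Notation C := (complex R).

(** A g-orthonormal basis [Th] presented with its adjoints [V], isometries with mutually orthogonal
    ranges. Joint injectivity stands in for the norm identity, which [gparseval] recovers. *)
Definition gcoordinates (Th : forall i, H -> H_ i) (V : forall i, H_ i -> H) :=
  [/\ forall i, adj (Th i) (V i), forall i, cancel (V i) (Th i),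
    forall i j x y, i <> j -> inner (V i x) (V j y) = 0 &
    forall f, (forall i, Th i f = 0) -> f = 0].

(** [V i] carries a basis of [H_ i] to its share [u i] of the basis of [H], and [Th i] is the
    reverse partial isometry. *)
Lemma gcoordinates_exist (Lambda : forall i : J, bounded_operator H (H_ i)) :
  separable_space H -> infinite_dimensional H ->
  (forall i : J, separable_space (H_ i)) ->
  (forall f, (forall i, Lambda i f = 0) -> f = 0) ->
  exists Th V, gcoordinates Th V.
Proof.
move=> Hsep Hinf Hisep Linj.
have [g [go g1 gt]] := infinite_orthonormal_basis Hsep Hinf.
pose e i := sval (cid (gram_schmidt (Hisep i))).
have eP i : [/\ orthogonal_seq (e i),
    forall n, inner (e i n) (e i n) = 1 \/ e i n = 0 & total_seq (e i)].
  exact: svalP (cid (gram_schmidt (Hisep i))).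
have eo i : orthogonal_seq (e i) by case: (eP i).
have e01 i n : inner (e i n) (e i n) = 1 \/ e i n = 0 by case: (eP i).
have et i : total_seq (e i) by case: (eP i).
have [u [uo ue ut]] := matched_basis e01 go g1 gt (infinite_coordinates et go g1 Linj).
have uio i : orthogonal_seq (u i) by move=> m n mn; apply: uo => -[].
have u01 i := unit_or0_transfer (e01 i) (ue i).
exists (fun i => transfer (u i) (e i)), (fun i => transfer (e i) (u i)); split.
- by move=> i; exact: transfer_adj.
- by move=> i x; exact: transferK.
- move=> i j x y ij; apply: transfer_ortho => // k.
  by apply/innerC0/transfer_ortho => // l; apply: uo => -[/esym].
move=> f f0; apply: ut => i k.
by rewrite -(transfer_basis _ (eo i) (e01 i) (ue i)) -transfer_adj// f0 inner0l.
Qed.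

Variables (Th : forall i, H -> H_ i) (V : forall i, H_ i -> H).
Arguments V : clear implicits.
Hypothesis ThV : gcoordinates Th V.

(* Sums over J are turned into series over nat by the partial inverse
   [pickle_inv] of the coding of J; unused codes contribute 0. *)
Let synth_term (g : forall i, H_ i) n : H :=
  oapp (fun i => V i (g i)) 0 (pickle_inv n : option J).
Let sqn (g : forall i, H_ i) n : R :=
  oapp (fun i => hnorm (g i) ^+ 2) 0 (pickle_inv n : option J).

Lemma sqn_ge0 g n : 0 <= sqn g n.
Proof. by rewrite /sqn; case: pickle_inv => //= i; rewrite exprn_ge0 ?hnorm_ge0. Qed.

Lemma esum_enum g : \esum_(i in [set: J]) (hnorm (g i) ^+ 2)%:E =
  (\sum_(n <oo) (sqn g n)%:E)%E.
Proof.
have pinj : set_inj [set: J] (@pickle J) by move=> i j _ _; exact: (pcan_inj pickleK).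
rewrite nneseries_esumT; last by move=> n; rewrite lee_fin sqn_ge0.
transitivity (\esum_(n in pickle @` [set: J]) (sqn g n)%:E).
  rewrite esum_image//; apply: eq_esum => i _.
  by rewrite /sqn pickleK_inv.
rewrite esum_mkcond; apply: eq_esum => n _; case: ifPn => // /negP nJ.
rewrite /sqn; case En : (pickle_inv n : option J) => [i|]//=; exfalso; apply: nJ.
rewrite inE; exists i => //.
by have := @pickle_invK J n; rewrite En.
Qed.

Lemma hnorm_V i x : hnorm (V i x) = hnorm x.
Proof.
by case: ThV => VA VK _ _; apply: adj_isometry (adj_sym (VA i)) (VK i x).
Qed.

Lemma hnorm_synth_term g n : hnorm (synth_term g n) ^+ 2 = sqn g n.
Proof.
rewrite /synth_term /sqn; case: pickle_inv => [i|] /=; first by rewrite hnorm_V.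
by rewrite hnorm0 expr0n.
Qed.

Lemma synth_term_ortho g : orthogonal_seq (synth_term g).
Proof.
case: ThV => _ _ VO _ m n mn; rewrite /synth_term.
have := @pickle_invK J m; have := @pickle_invK J n.
case: pickle_inv => [j|] /=; last by rewrite inner0r.
case: pickle_inv => [i|] /=; last by rewrite inner0l.
by move=> jn im; apply: VO => ij; apply: mn; rewrite -im -jn ij.
Qed.

Lemma sqn_bound_esum g (B : R) :
  (\esum_(i in [set: J]) (hnorm (g i) ^+ 2)%:E <= B%:E)%E ->
  forall n, \sum_(0 <= k < n) sqn g k <= B.
Proof.
move=> hB n; rewrite -lee_fin; apply: le_trans hB; rewrite esum_enum -sumEFin.
by apply: nneseries_lim_ge => k _; rewrite lee_fin sqn_ge0.
Qed.

(** The vector [h] is the sum of the orthogonal vectors [V i (g i)], convergent because their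
    squared norms are summable. *)
Lemma synthesis g (B : R) : (forall n, \sum_(0 <= k < n) sqn g k <= B) ->
  exists h, (forall i, Th i h = g i) /\
    \esum_(i in [set: J]) (hnorm (g i) ^+ 2)%:E = (hnorm h ^+ 2)%:E.
Proof.
move=> gB; have [VA VK VO Vt] := ThV.
have xo := synth_term_ortho g.
have hc : cvg (series (synth_term g) @ \oo).
  apply: cvg_orthogonal_series xo _ => n; apply: le_trans (gB n).
  by apply: ler_sum => k _; rewrite hnorm_synth_term.
exists (lim (series (synth_term g) @ \oo)); split=> [i|].
  apply: eq_inner => y; rewrite VA -[g i]VK VA.
  have cst : (fun _ : nat => V i y) @ \oo --> V i y by exact: cvg_cst.
  have cl := cvg_inner hc cst.
  apply: (@cvg_unique C^o (@norm_hausdorff _ _) _ _ _ _ cl).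
  (* Once the partial sum includes the code of [i], the inner product is constant: all other terms
     are orthogonal to the range of [V i]. *)
  apply: cvg_near_cst; exists (pickle i).+1 => // n /= ni.
  rewrite inner_suml (bigD1_seq (pickle i)) ?iota_uniq ?mem_index_iota//=.
  rewrite big1_seq ?addr0 /synth_term ?pickleK_inv// => k /andP[ki _].
  have := @pickle_invK J k; case: pickle_inv => [j|] /=; last by rewrite inner0l.
  by move=> jk; apply: VO => ji; rewrite -jk ji eqxx in ki.
rewrite esum_enum; apply: cvg_lim => //.
have := cvg_series_hnorm2 xo hc; set l := hnorm _ ^+ 2 => hl.
rewrite [F in F @ _](_ : _ = EFin \o series (fun k => hnorm (synth_term g k) ^+ 2)).
  exact: (cvg_comp _ _ hl).
apply/funext => n /=; rewrite /series /= -sumEFin.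
by apply: eq_bigr => k _; rewrite hnorm_synth_term.
Qed.

Lemma gcoordinates_inj f h : (forall i, Th i f = Th i h) -> f = h.
Proof.
move=> fh; apply/eqP; rewrite -subr_eq0; apply/eqP.
case: ThV => VA _ _; apply => i.
by rewrite (adj_linB _ _ (VA i)) fh subrr.
Qed.

(** [V i (Th i f)] is the projection of [f] onto the range of [V i], and it has the norm of
    [Th i f]. *)
Lemma hnorm_Th i f : hnorm (Th i f) <= hnorm f.
Proof.
case: ThV => VA VK _ _; rewrite -hnorm_V; apply: hnorm_proj_le.
by rewrite -VA -[in RHS]VA VK.
Qed.

(** A Bessel estimate makes the coordinates of [f] square-summable; the vector synthesized from them
    has the same coordinates, so it is [f]. *)
Lemma gparseval f : \esum_(i in [set: J]) (hnorm (Th i f) ^+ 2)%:E = (hnorm f ^+ 2)%:E.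
Proof.
have [VA VK VO Vt] := ThV.
have [|h [hf ->]] := @synthesis (fun i => Th i f) (hnorm f ^+ 2); last first.
  by rewrite (gcoordinates_inj hf).
move=> n; under eq_bigr do rewrite -hnorm_synth_term.
rewrite -(hnorm2_sum (synth_term_ortho _)) ?iota_uniq//.
rewrite ler_pXn2r ?nnegrE ?hnorm_ge0//; apply: hnorm_proj_le.
rewrite inner_suml inner_sumr; apply: eq_big_seq => k kn.
rewrite inner_sumr (bigD1_seq k) ?iota_uniq//= big1_seq ?addr0.
  rewrite /synth_term; case: pickle_inv => [i|] /=; last by rewrite inner0r inner0l.
  by rewrite -VA -[in RHS]VA VK.
by move=> j /andP[jk _]; apply: synth_term_ortho => kj; rewrite kj eqxx in jk.
Qed.

End gcoordinates.

(** * From unitaries to g-orthonormal bases, and the decomposition *)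

Section gorthonormal_basis_construction.
Context {R : realType} {J : set int} {H : hilbertType R} {H_ : J -> hilbertType R}.
Variables (Th : forall i, H -> H_ i) (V : forall i, H_ i -> H).
Arguments V : clear implicits.
Hypothesis ThV : gcoordinates Th V.

Lemma adj_bounded_operator (K L : hilbertType R) (T : K -> L) (T' : L -> K) :
  adj T T' -> (forall x, hnorm (T x) <= hnorm x) ->
  {B : bounded_operator K L | forall x, B x = T x}.
Proof.
move=> TT Tb; pose lin := GRing.isLinear.Build _ _ _ _ T (adj_linear TT).
pose Tl : {linear K -> L} := HB.pack T lin.
have Tlb : exists M : R, forall f, hnorm (Tl f) <= M * hnorm f.
  by exists 1 => f; rewrite mul1r; exact: Tb.
by exists (BoundedOperator Tlb).
Qed.

(** The adjoint of [Th i \o U] is [U' \o V i]. As U U' = 1, the orthogonality relations reduce to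
    those of [V]; as [U] is isometric, the norm identity reduces to [gparseval]. *)
Lemma gorthonormal_basis_unitary U U' : unitary U U' ->
  exists Ups : forall i, bounded_operator H (H_ i),
    gorthonormal_basis Ups /\ forall i f, Ups i f = Th i (U f).
Proof.
case=> UU UK U'K; have [VA VK VO _] := ThV.
have ThU i : adj (Th i \o U) (U' \o V i) by exact: adj_comp UU (VA i).
have ThUb i f : hnorm ((Th i \o U) f) <= hnorm f.
  by rewrite -(adj_isometry UU (UK f)); exact: (hnorm_Th ThV).
pose Ups i := sval (adj_bounded_operator (ThU i) (ThUb i)).
have UpsE i f : Ups i f = Th i (U f).
  exact: svalP (adj_bounded_operator (ThU i) (ThUb i)) f.
have UpsA i : adjoint (Ups i) = U' \o V i.
  by apply: adjE => x y; rewrite UpsE; exact: ThU.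
exists Ups; split=> //; split.
- by move=> i g g'; rewrite UpsA -[LHS]UU /= U'K -VA VK.
- by move=> i j gi gj ij; rewrite !UpsA -[LHS]UU /= U'K VO.
move=> f; rewrite -(adj_isometry UU (UK f)) -(gparseval ThV).
by apply: eq_esum => i _; rewrite UpsE.
Qed.

End gorthonormal_basis_construction.

(** Makes [- Th i] a g-orthonormal basis, the one that cancels the 1 in 1 + S. *)
Lemma opp_unitary {R : realType} (H : hilbertType R) :
  unitary (@GRing.opp H) (@GRing.opp H).
Proof.
by split=> [x y|x|x]; rewrite ?opprK// innerNl innerNr.
Qed.

(** If all terms vanish, the lower frame bound leaves A |f|^2 <= 0. *)
Lemma gframe_inj {R : realType} {J : set int} (H : hilbertType R)
    (H_ : J -> hilbertType R) (Lambda : forall i : J, bounded_operator H (H_ i)) :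
  gframe Lambda -> forall f, (forall i, Lambda i f = 0) -> f = 0.
Proof.
move=> [A [B [A0 B0 AB]]] f Lf; have /andP[+ _] := AB f.
rewrite esum1; last by move=> i _; rewrite Lf hnorm0 expr0n.
rewrite lee_fin pmulr_rle0// => f0; apply/hnorm_eq0/eqP.
by rewrite -sqrf_eq0 eq_le f0 sqr_ge0.
Qed.

Theorem proposition2p1 (R : realType) (J : set int)
    (H : hilbertType R) (H_ : J -> hilbertType R)
    (Lambda : forall i : J, bounded_operator H (H_ i)) :
  separable_space H -> infinite_dimensional H ->
  (forall i : J, separable_space (H_ i)) ->
  gframe Lambda ->
  exists (Upsilon Gamma Psi : forall i : J, bounded_operator H (H_ i)) (a : complex R),
    [/\ gorthonormal_basis Upsilon, gorthonormal_basis Gamma, gorthonormal_basis Psi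
      & forall (i : J) (f : H), Lambda i f = a *: (Upsilon i f + Gamma i f + Psi i f)].
Proof.
move=> Hsep Hinf Hisep Lframe.
have [Th [V ThV]] := gcoordinates_exist Hsep Hinf Hisep (gframe_inj Lframe).
have [VA _ _ _] := ThV.
have [A [B [_ B0 AB]]] := Lframe.
(* The upper frame bound makes the family [Lambda i f] square-summable, so it is the coordinate
   family of a vector, to be called [T f]. *)
have Tex f : exists h, (forall i, Th i h = Lambda i f) /\
    \esum_(i in [set: J]) (hnorm (Lambda i f) ^+ 2)%:E = (hnorm h ^+ 2)%:E.
  have /andP[_ Bf] := AB f.
  exact: (synthesis ThV (@sqn_bound_esum _ _ _ (fun i => Lambda i f) _ Bf)).
pose T f := sval (cid (Tex f)).
have ThT i f : Th i (T f) = Lambda i f by have [] := svalP (cid (Tex f)).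
have Tb f : hnorm (T f) <= Num.sqrt B * hnorm f.
  have [_ Tf] := svalP (cid (Tex f)); have /andP[_] := AB f.
  rewrite Tf lee_fin -{1}(sqr_sqrtr (ltW B0)) -exprMn ler_pXn2r//.
    by rewrite nnegrE hnorm_ge0.
  by rewrite nnegrE mulr_ge0 ?hnorm_ge0 ?sqrtr_ge0.
have Tlin : linear T.
  move=> a x y; apply: (gcoordinates_inj ThV) => i.
  by rewrite (adj_linD _ _ (VA i)) (adj_linZ _ _ (VA i)) !ThT linearP.
have [T' TT] := adj_exists Hsep Tlin Tb.
have B1 : 0 < Num.sqrt B + 1 by rewrite ltr_wpDl ?sqrtr_ge0.
(* Chosen so that eps sqrt(B) <= 1/50, the smallness that [sum_of_unitaries] asks of [S]. *)
pose eps := (50 * (Num.sqrt B + 1))^-1.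
have eps0 : 0 < eps by rewrite invr_gt0 mulr_gt0.
pose S x := eps%:C%C *: T x; pose S' x := eps%:C%C *: T' x.
have SS : adj S S'.
  move=> x y; rewrite innerZl innerZr TT; congr (_ * _).
  by apply/esym/conj_Creal/complex_realP; exists eps.
have Sb x : hnorm (S x) <= 50^-1 * hnorm x.
  rewrite hnormZr gtr0_norm// /eps invfM -mulrA ler_pM2l ?invr_gt0//.
  rewrite mulrC ler_pdivrMr// mulrC; apply: le_trans (Tb x) _.
  by rewrite ler_wpM2r ?hnorm_ge0// lerDl.
have [U1 [U1' [U2 [U2' [u1 u2 SU]]]]] := sum_of_unitaries SS Sb.
have [Ups [Upsb UpsE]] := gorthonormal_basis_unitary ThV u1.
have [Gam [Gamb GamE]] := gorthonormal_basis_unitary ThV u2.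
have [Psi [Psib PsiE]] := gorthonormal_basis_unitary ThV (opp_unitary H).
exists Ups, Gam, Psi, (eps%:C%C)^-1; split=> // i f.
(* The three operators add up to [Th i] applied to U1 + U2 - 1 = S = eps T, that is to eps times
   [Lambda i]; hence the constant 1 / eps. *)
rewrite UpsE GamE PsiE -!(adj_linD _ _ (VA i)) -SU addrAC subrr add0r.
rewrite (adj_linZ _ _ (VA i)) scalerA mulVf ?scale1r ?ThT//.
by rewrite (inj_eq (@complexI R)) gt_eqF.
Qed.
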